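(* Let $\{\gamma(t)\}_{t\in[0,1]}$ be a cylindrical continuous Gaussian process on a separable Hilbert space $\mathbb H$ with zero mean (with respect to an orthonormal basis $\{e_i\}_{i\ge1}$), and let $\delta_i$, $i\ge1$, be the associated quantities defined in the context. Suppose that $$\theta:=\sum_{i=1}^\infty\delta_i^2\log(\mathrm e+\delta_i^{-1})<\infty.$$ Then, for any positive constant $\lambda<\min_{i\ge1}\frac{\log(\mathrm e+\delta_i^{-1})}{2\theta}$, there exists a constant $c>0$ such that $$\mathbb P\Big(\max_{t\in[0,1]}|\gamma(t)|\ge r\Big)\le c\,\mathrm e^{-\lambda r^2},\quad r\ge0.$$
   Context: A process $\{\gamma(t)\}_{t\in[0,1]}$ on the Hilbert space $\mathbb H$ (norm $|\cdot|$) is called a cylindrical continuous Gaussian process if, for an orthonormal basis $\{e_i\}_{i\ge1}$ of $\mathbb H$, every one-dimensional process $\gamma_i(t):=\langle\gamma(t),e_i\rangle$ is a continuous Gaussian process. For such a process with zero mean, put $$\phi_i(r)=\sup_{s,t\in[0,1],\,|s-t|\le r}\big(\mathbb E|\gamma_i(t)-\gamma_i(s)|^2\big)^{1/2},\quad r\in[0,1],$$ $$\Gamma_i=\sup_{t\in[0,1]}\big(\mathbb E\gamma_i(t)^2\big)^{1/2},\qquad \delta_i=\Gamma_i+(2+\sqrt2)\int_1^\infty\phi_i(\mathrm e^{-s^2})\,\mathrm ds,\quad i\ge1.$$ Convention: if $\delta_i=0$, then $\delta_i^2\log(\mathrm e+\delta_i^{-1}):=0$ and $\log(\mathrm e+\delta_i^{-1}):=+\infty$;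 if $\theta=0$, the upper bound on $\lambda$ is $+\infty$. *)

(* Defs.v *)
From HB Require Import structures.
From mathcomp Require Import all_boot all_order all_algebra.
From mathcomp Require Import all_classical all_reals all_analysis.

Set Implicit Arguments.
Unset Strict Implicit.
Unset Printing Implicit Defensive.

Import Order.TTheory GRing.Theory Num.Theory.
Import numFieldNormedType.Exports.

Local Open Scope classical_set_scope.
Local Open Scope ring_scope.

Definition separable (T : topologicalType) : Prop :=
  exists2 D : set T, countable D & dense D.

(* A real Hilbert space is a [completeNormedModType R] whose norm is induced
   by an inner product. *)
Definition norm_induced_by (R : realType) (H : completeNormedModType R)
    (dot : {dot H for idfun}) : Prop :=
  forall x : H, `|x| ^+ 2 = dot x x.

(* The index set is an arbitrary countable type, so that finite-dimensional
   spaces are covered together with the case of a sequence. *)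
Definition orthonormal_basis (R : realType) (H : completeNormedModType R)
    (dot : {dot H for idfun}) (I : countType) (e : I -> H) : Prop :=
  (forall i j : I, dot (e i) (e j) = (i == j)%:R) /\
  dense [set x : H | exists (s : seq I) (a : I -> R),
                       x = \sum_(i <- s) a i *: e i].

Section process.
Context (d : measure_display) (T : measurableType d) (R : realType)
  (P : probability T R).
Implicit Types X : R -> T -> R.

(* Gaussian variables may be degenerate, whereas [normal_prob m 0] is a junk
   value (the uniform law on [0, 1]). *)
Definition gaussian_law (m s : R) : set R -> \bar R :=
  if s == 0 then \d_m else normal_prob m s.

Definition gaussian_rv (Y : T -> R) : Prop :=
  measurable_fun [set: T] Y /\
  exists m s : R, 0 <= s /\
    forall A : set R, measurable A ->
      pushforward P Y A = gaussian_law m s A.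

(* The finite-dimensional distributions are Gaussian vectors, i.e. all linear
   combinations of their coordinates are Gaussian. *)
Definition gaussian_process X : Prop :=
  forall (n : nat) (t a : 'I_n -> R), (forall k, t k \in `[0, 1]) ->
    gaussian_rv (fun w => \sum_(k < n) a k * X (t k) w).

Definition continuous_process X : Prop :=
  forall w : T, {within `[0, 1], continuous (fun t => X t w)}.

Definition zero_mean X : Prop :=
  forall t : R, t \in `[0, 1] -> 'E_P[X t]%E = 0%E.

Local Open Scope ereal_scope.

(* phi_i, Gamma_i and delta_i of the real process X = gamma_i; all of them are
   extended reals, delta being +oo when the integral diverges. *)
Definition phi X (r : R) : \bar R :=
  ereal_sup [set y | exists s t : R,
    [/\ s \in `[0%R, 1%R], t \in `[0%R, 1%R], (`|s - t| <= r)%R &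
        y = sqrte 'E_P[fun w => (`|X t w - X s w| ^+ 2)%R]]].

Definition Gamma X : \bar R :=
  ereal_sup [set y | exists t : R,
    t \in `[0%R, 1%R] /\ y = sqrte 'E_P[fun w => (X t w ^+ 2)%R]].

Definition delta X : \bar R :=
  Gamma X + (2 + Num.sqrt 2)%:E *
    \int[lebesgue_measure]_(s in `[1%R, +oo[) phi X (expR (- s ^+ 2)).

(* log (e + x^-1) *)
Definition logterm (x : \bar R) : \bar R := lne ((expR 1)%:E + x^-1).

End process.

(* Since 0^-1 = +oo and 0 * +oo = 0 in \bar R, the expressions x ^+ 2 * logterm x
   and logterm x / (2 * theta) take the conventional values when x = 0 or
   theta = 0. *)
Lemma logterm0 (R : realType) : logterm (0 : \bar R)%E = +oo%E.
Proof. by rewrite /logterm inve0 addey. Qed.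

Lemma sqr_logterm0 (R : realType) :
  (0 ^+ 2 * logterm (0 : \bar R) = 0)%E.
Proof. by rewrite expe2 !mul0e. Qed.

Lemma logterm_div0 (R : realType) (x : \bar R) :
  (0 <= x)%E -> (logterm x / (2%:E * 0) = +oo)%E.
Proof.
move=> x0; rewrite mule0 inve0 gt0_muley// ltNge; apply/negP => l0.
have : (lne (1 : \bar R) < logterm x)%E.
  rewrite /logterm lte_lne//.
  - have xV : (0 <= x^-1)%E by rewrite inve_ge0.
    by rewrite (@lt_le_trans _ _ (expR 1)%:E)// ?leeDl// lte_fin expR_gt1.
  - by rewrite in_itv/= lee_fin ler01 leey.
  - by rewrite in_itv/= leey andbT adde_ge0// ?inve_ge0// lee_fin expR_ge0.
by rewrite lne1 ltNge l0.
Qed.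

Section cylindrical.
Context (d : measure_display) (T : measurableType d) (R : realType)
  (P : probability T R) (H : completeNormedModType R)
  (dot : {dot H for idfun}) (I : countType) (e : I -> H).

Definition coordinate (gamma : R -> T -> H) (i : I) : R -> T -> R :=
  fun t w => dot (gamma t w) (e i).

Definition cylindrical_continuous_gaussian (gamma : R -> T -> H) : Prop :=
  forall i : I, gaussian_process P (coordinate gamma i) /\
                continuous_process (coordinate gamma i).

Definition cylindrical_zero_mean (gamma : R -> T -> H) : Prop :=
  forall i : I, zero_mean P (coordinate gamma i).

Local Open Scope ereal_scope.

Definition theta (gamma : R -> T -> H) : \bar R :=
  \esum_(i in [set: I])
    delta P (coordinate gamma i) ^+ 2 * logterm (delta P (coordinate gamma i)).

End cylindrical.

(* Sup of the norm of the path over [0, 1]. For continuous coordinates the path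
   is lower semicontinuous in norm, so this is a measurable function of w. *)
Definition sup_norm (T : Type) (R : realType) (H : completeNormedModType R)
    (gamma : R -> T -> H) (w : T) : \bar R :=
  ereal_sup [set y | exists t : R, t \in `[0%R, 1%R] /\ y = `|gamma t w|%:E].

(* Main.v *)
Require Import Defs.
From HB Require Import structures.
From mathcomp Require Import all_boot all_order all_algebra.
From mathcomp Require Import all_classical all_reals all_analysis.
From mathcomp Require Import measurable_realfun ring lra.
Import Order.TTheory GRing.Theory Num.Theory.
Import numFieldNormedType.Exports.
Local Open Scope classical_set_scope.
Local Open Scope ring_scope.

(** The coordinates are controlled one at a time by Fernique's inequality: for a
   continuous Gaussian process X on [0, 1] and large x,
   P(sup |X| > x delta) <= C exp(-x^2/2). It is proved by chaining along the
   grids of mesh 4^(-2^(n+1)): an increment between consecutive grids exceeds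
   x 2^((n+1)/2) phi(mesh) with probability O(exp(-x^2 2^n)), which beats the
   number of pairs of grid points, while the thresholds sum to at most
   x (2 + sqrt 2) \int phi(exp(-s^2)) ds.

   With tau_i = delta_i^2 L_i and L_i = log(e + 1/delta_i), one applies this with
   x_i = r sqrt(L_i / theta). Outside the exceptional events
   |gamma_i| <= r sqrt(tau_i / theta) for every i, and these bounds have l2-norm
   at most r. For r^2 >= 4 theta the probability of the i-th event is at most a
   constant times exp(-lambda r^2) exp(-2 L_i) <= exp(-lambda r^2) tau_i, which
   is summable; no relation between the coordinates is used. *)

(** * Gaussian laws *)

(** Exponential tilting: [K] times the normal density with mean [m + a * s ^+ 2] is
    [expR (a * x - b)] times the original density, hence dominates it on [A], and the tilted density
    has total mass 1. *)
Lemma normal_prob_chernoff (R : realType) (m s a b : R) (A : set R) :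
  s != 0 -> measurable A -> (forall x, A x -> b <= a * x) ->
  (normal_prob m s A <= (expR (a * m + a ^+ 2 * s ^+ 2 / 2 - b))%:E)%E.
Proof.
move=> s0 mA hA; set K := expR _.
have mf m' : measurable_fun [set: R] (fun x => (normal_pdf m' s x)%:E).
  by apply/measurable_EFinP; exact: measurable_normal_pdf.
have pdf0 (m' x : R) : (0 <= (normal_pdf m' s x)%:E)%E by rewrite lee_fin normal_pdf_ge0.
have mK : measurable_fun [set: R]
    (fun x => (K%:E * (normal_pdf (m + a * s ^+ 2) s x)%:E)%E).
  by apply: emeasurable_funM => //; exact: measurable_cst.
have -> : K%:E = (\int[lebesgue_measure]_x
    (K%:E * (normal_pdf (m + a * s ^+ 2) s x)%:E))%E.
  rewrite ge0_integralZl//; [|exact: mf|by rewrite lee_fin expR_ge0].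
  by rewrite integral_normal_pdf mule1.
rewrite /normal_prob. 
apply: (@le_trans _ _ (\int[lebesgue_measure]_(x in A)
    (K%:E * (normal_pdf (m + a * s ^+ 2) s x)%:E))%E); last first.
  apply: ge0_subset_integral => //.
  by move=> x _; rewrite mule_ge0// lee_fin expR_ge0.
apply: ge0_le_integral => //.
- apply: measurable_funTS; exact: mf.
- apply: measurable_funTS; exact: mK.
- move=> x Ax; rewrite -EFinM lee_fin !normal_pdfE//.
  rewrite mulrCA ler_wpM2l ?normal_peak_ge0// /normal_fun /K -expRD ler_expR.
  have := hA _ Ax; rewrite -subr_ge0 => h.
  rewrite -subr_ge0; set v := (X in 0 <= X).
  suff -> : v = a * x - b by [].
  by rewrite /v -mulr_natr; field.
Qed.

(** The Radon-Nikodym derivative of [normal_prob m s] and its explicit density have the same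
    integral over every measurable set, so they agree almost everywhere. *)
Lemma ge0_integral_normal_prob (R : realType) (m s : R) (f : R -> \bar R) :
  measurable_fun [set: R] f -> (forall x, 0 <= f x)%E ->
  (\int[normal_prob m s]_x f x =
   \int[lebesgue_measure]_x (f x * (normal_pdf m s x)%:E))%E.
Proof.
move=> mf f0.
have dom := normal_prob_dominates m s.
rewrite -(Radon_Nikodym_SigmaFinite.change_of_variables dom)//.
have ig := Radon_Nikodym_SigmaFinite.f_integrable dom.
apply: ae_eq_integral => //.
- by apply: emeasurable_funM => //; exact: measurable_int ig.
- apply: emeasurable_funM => //; apply/measurable_EFinP.
  exact: measurable_normal_pdf.
- apply: ae_eqe_mul2l; apply: integral_ae_eq => //.
  + by apply/measurable_EFinP; exact: measurable_normal_pdf.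
  + by move=> E _ mE; rewrite -Radon_Nikodym_SigmaFinite.f_integral.
Qed.

(* The Laplace transform of x^2 at c = (D^2 - 1) / (2 s^2), for which
   sqrt (1 + 2 c s^2) = D. *)
Lemma integral_normal_prob_gauss (R : realType) (m s D : R) :
  0 < s -> 0 < D ->
  (\int[normal_prob m s]_x (expR (- ((D ^+ 2 - 1) / (2 * s ^+ 2)) * x ^+ 2))%:E =
   (D^-1 * expR (- ((D ^+ 2 - 1) / (2 * s ^+ 2)) * m ^+ 2 / D ^+ 2))%:E)%E.
Proof.
move=> s0 D0; set c := (D ^+ 2 - 1) / _.
have mg : measurable_fun [set: R] (fun x => (expR (- c * x ^+ 2))%:E).
  apply/measurable_EFinP; apply: measurableT_comp => //.
  by apply: measurable_funM => //; exact: measurable_funX.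
rewrite (ge0_integral_normal_prob _ _ _ _ mg); last first.
  by move=> x; rewrite lee_fin expR_ge0.
set K := (D^-1 * _).
transitivity (\int[lebesgue_measure]_x
   (K%:E * (normal_pdf (m / D ^+ 2) (s / D) x)%:E))%E.
  (* Completing the square turns the integrand into a multiple of the normal density with mean
     [m / D ^+ 2] and deviation [s / D]. *)
  apply: eq_integral => x _; rewrite -!EFinM; congr EFin.
  rewrite !normal_pdfE ?gt_eqF ?divr_gt0// /normal_peak /normal_fun /K.
  have -> : (s / D) ^+ 2 * pi *+ 2 = (D^-1)^+2 * (s ^+ 2 * pi *+ 2).
    by rewrite exprMn [in LHS]mulrAC [in LHS]mulrC -[in LHS]mulrnAr.
  rewrite sqrtrM ?sqr_ge0// sqrtr_sqr gtr0_norm ?invr_gt0//.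
  rewrite (invfM D^-1) invrK -(mulrA D) [RHS]mulrACA mulVf ?gt_eqF// mul1r.
  rewrite mulrCA [RHS]mulrCA -!expRD; congr (_ * expR _).
  rewrite /c; field.
  by rewrite !gt_eqF.
rewrite ge0_integralZl//; last 3 first.
- by apply/measurable_EFinP; exact: measurable_normal_pdf.
- by move=> x _; rewrite lee_fin normal_pdf_ge0.
- by rewrite lee_fin mulr_ge0 ?expR_ge0 ?invr_ge0 ?ltW.
by rewrite integral_normal_pdf mule1.
Qed.

Lemma ge0_expectation_law (R : realType) (d : measure_display)
    (T : measurableType d) (P : probability T R) (Y : T -> R)
    (nu : {measure set (measurableTypeR R) -> \bar R}) (f : R -> R) :
  measurable_fun [set: T] Y ->
  (forall A, measurable A -> pushforward P Y A = nu A) ->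
  measurable_fun [set: R] f -> (forall x, 0 <= f x) ->
  ('E_P[f \o Y] = \int[nu]_x (f x)%:E)%E.
Proof.
move=> mY lawY mf f0.
pose mX := isMeasurableFun.Build _ _ T (measurableTypeR R) Y mY.
pose X : {RV P >-> measurableTypeR R} := HB.pack Y mX.
rewrite (@eq_measure_integral _ _ _ _ (distribution P X) nu); last first.
  by move=> A mA _; rewrite -lawY.
rewrite ge0_integral_distribution//.
- by rewrite unlock.
- exact/measurable_EFinP.
Qed.

(* From c E[Y^2] >= E[1 - exp(-c Y^2)] and the explicit Laplace transform, letting
   c tend to 0, i.e. D tend to 1. *)
Lemma law_second_moment_ge (R : realType) (d : measure_display)
    (T : measurableType d) (P : probability T R) (Y : T -> R) (m s : R) :
  measurable_fun [set: T] Y -> 0 <= s ->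
  (forall A, measurable A -> pushforward P Y A = gaussian_law m s A) ->
  ((m ^+ 2 + s ^+ 2)%:E <= 'E_P[fun w => (Y w ^+ 2)%R])%E.
Proof.
move=> mY; rewrite le_eqVlt => /predU1P[<-|s0] lawY.
  rewrite expr0n addr0.
  rewrite (@ge0_expectation_law _ _ _ _ _ (\d_(m : measurableTypeR R)) (fun x => x ^+ 2))//.
  - rewrite integral_dirac//; last by apply/measurable_EFinP; exact: measurable_funX.
    by rewrite diracT mul1e.
  - by move=> A /lawY; rewrite /gaussian_law eqxx.
  - by move=> x; exact: sqr_ge0.
case: (leP +oo%E 'E_P[fun w => (Y w ^+ 2)%R])%E => [/(le_trans _)->//|Vfin].
  exact: leey.
have V0 : (0 <= 'E_P[fun w => (Y w ^+ 2)%R])%E.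
  by apply: expectation_ge0 => w; exact: sqr_ge0.
have [V EV] : exists V : R, 'E_P[fun w => (Y w ^+ 2)%R]%E = V%:E.
  by exists (fine 'E_P[fun w => (Y w ^+ 2)%R]%E); rewrite fineK// ge0_fin_numE.
rewrite EV lee_fin.
have key D c : 1 < D -> c = (D ^+ 2 - 1) / (2 * s ^+ 2) ->
    1 - D^-1 * expR (- c * m ^+ 2 / D ^+ 2) <= c * V.
  move=> D1 cE.
  have c0 : 0 < c by rewrite cE divr_gt0 ?mulr_gt0 ?exprn_gt0// subr_gt0 expr_gt1// ltW// (lt_trans ltr01).
  have mg : measurable_fun [set: R] (fun x => expR (- c * x ^+ 2)).
    by apply: measurableT_comp => //; apply: measurable_funM => //; exact: measurable_funX.
  have EK : ('E_P[fun w => expR (- c * Y w ^+ 2)%R] =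
      (D^-1 * expR (- c * m ^+ 2 / D ^+ 2))%:E)%E.
    rewrite cE -(integral_normal_prob_gauss R m s D s0 (lt_trans ltr01 D1)) -cE.
    rewrite -(@ge0_expectation_law _ _ _ P Y (normal_prob m s)
      (fun x => expR (- c * x ^+ 2)))//.
    by move=> A /lawY; rewrite /gaussian_law gt_eqF.
  rewrite -lee_fin EFinM -EV EFinB -EK leeBlDr//; last by rewrite EK.
  rewrite unlock -ge0_integralZl ?lee_fin ?(ltW c0)//; last 2 first.
  - by apply/measurable_EFinP; exact: measurable_funX.
  - by move=> x _; rewrite lee_fin sqr_ge0.
  have mcY : measurable_fun [set: T] (fun w => (c%:E * (Y w ^+ 2)%:E)%E).
    by apply/measurable_EFinP; apply: measurable_funM => //; exact: measurable_funX.
  have mgY : measurable_fun [set: T] (fun w => (expR (- c * Y w ^+ 2))%:E).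
    by apply/measurable_EFinP; exact: (measurableT_comp mg).
  rewrite -ge0_integralD//; last first.
    by move=> w _; rewrite -EFinM lee_fin mulr_ge0 ?sqr_ge0// ltW.
  apply: (@le_trans _ _ (\int[P]_w (cst 1%E w))%E).
    by rewrite integral_cst//= probability_setT mule1.
  apply: ge0_le_integral => //.
  - exact: emeasurable_funD.
  - move=> w _ /=; rewrite -EFinM -EFinD lee_fin.
    by have := @expR_ge1Dx _ (- c * Y w ^+ 2); lra.
(* [key] with exp(-u) replaced by its upper bound 1/(1 + u), then divided by [c]. Both sides are now
   polynomial in [D], so the limit at 1 can be taken termwise. *)
have poly D c : 1 < D -> c = (D ^+ 2 - 1) / (2 * s ^+ 2) ->
    s ^+ 2 * 2 * (D ^+ 2 + c * m ^+ 2) + (D + 1) * m ^+ 2 <=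
    V * (D * ((D + 1) * (D ^+ 2 + c * m ^+ 2))).
  move=> D1 cE; have h := key D c D1 cE.
  have D0 : 0 < D by lra.
  have D20 : 0 < D ^+ 2 by rewrite exprn_gt0.
  have c0 : 0 < c.
    by rewrite cE divr_gt0 ?mulr_gt0 ?exprn_gt0// subr_gt0 expr_gt1// ltW.
  have m0 : 0 <= c * m ^+ 2 by rewrite mulr_ge0 ?sqr_ge0// ltW.
  have W0 : 0 < D ^+ 2 + c * m ^+ 2 by lra.
  have {h} : 1 - D^-1 * (D ^+ 2 / (D ^+ 2 + c * m ^+ 2)) <= c * V.
    apply: le_trans h; rewrite lerD2l lerN2 ler_wpM2l// ?invr_ge0 ?(ltW D0)//.
    rewrite -[leLHS]invrK -[leRHS]invrK lef_pV2 ?posrE ?invr_gt0 ?divr_gt0 ?expR_gt0//.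
    rewrite -expRN invf_div mulrDl divff ?gt_eqF//.
    by apply: le_trans (expR_ge1Dx _); rewrite !mulNr opprK.
  have -> : 1 - D^-1 * (D ^+ 2 / (D ^+ 2 + c * m ^+ 2)) =
     c * (s ^+ 2 * 2 * (D ^+ 2 + c * m ^+ 2) + (D + 1) * m ^+ 2) /
     (D * ((D + 1) * (D ^+ 2 + c * m ^+ 2))).
    have cE' : c * (s ^+ 2 * 2) = (D - 1) * (D + 1).
      by rewrite cE; field; rewrite gt_eqF.
    rewrite mulrDr [c * (_ * (D ^+ 2 + _))]mulrA cE'.
    field; rewrite ?gt_eqF//; lra.
  rewrite ler_pdivrMr ?mulr_gt0//; last by lra.
  by rewrite -(mulrA c V) ler_pM2l.
have lim1 : (fun D : R => s ^+ 2 * 2 * (D ^+ 2 + (D ^+ 2 - 1) / (2 * s ^+ 2) * m ^+ 2) + (D + 1) * m ^+ 2) D @[D --> 1^'+] -->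
   s ^+ 2 * 2 * (1 ^+ 2 + (1 ^+ 2 - 1) / (2 * s ^+ 2) * m ^+ 2) + (1 + 1) * m ^+ 2.
  by apply: cvg_at_right_filter; do !(apply: cvgD || apply: cvgM || exact: cvg_cst || exact: cvg_id).
have lim2 : (fun D : R => V * (D * ((D + 1) * (D ^+ 2 + (D ^+ 2 - 1) / (2 * s ^+ 2) * m ^+ 2)))) D @[D --> 1^'+] -->
   V * (1 * ((1 + 1) * (1 ^+ 2 + (1 ^+ 2 - 1) / (2 * s ^+ 2) * m ^+ 2))).
  by apply: cvg_at_right_filter; do !(apply: cvgD || apply: cvgM || exact: cvg_cst || exact: cvg_id).
(* At [D = 1] the inequality reads 2 s^2 + 2 m^2 <= 2 V. *)
suff : s ^+ 2 * 2 * (1 ^+ 2 + (1 ^+ 2 - 1) / (2 * s ^+ 2) * m ^+ 2) + (1 + 1) * m ^+ 2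
    <= V * (1 * ((1 + 1) * (1 ^+ 2 + (1 ^+ 2 - 1) / (2 * s ^+ 2) * m ^+ 2))).
  by rewrite expr1n subrr !mul0r; lra.
apply: (ler_cvg_to lim1 lim2); near=> D.
by apply: poly => //; near: D; exact: nbhs_right_gt.
Unshelve. all: end_near. Qed.

Lemma gaussian_law_chernoff (R : realType) (m s a b : R) (A : set R) :
  measurable A -> (forall x, A x -> b <= a * x) ->
  (gaussian_law m s A <= (expR (a * m + a ^+ 2 * s ^+ 2 / 2 - b))%:E)%E.
Proof.
move=> mA hA; rewrite /gaussian_law; case: eqVneq => [->|s0]; last first.
  exact: normal_prob_chernoff.
rewrite expr0n mulr0 mul0r addr0 diracE lee_fin.
case: (boolP (m \in A)) => [mAm|_]; last exact: expR_ge0.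
rewrite -[leLHS]expR0 ler_expR subr_ge0; apply: hA; exact: set_mem.
Qed.

(* No centering is needed: with m^2 + s^2 <= g^2, the Chernoff exponent at
   a = y / g is at most 1/2 - y^2/2 - (y m / g - 1)^2/2. *)
Lemma gaussian_rv_tail (R : realType) (d : measure_display)
    (T : measurableType d) (P : probability T R) (Y : T -> R) (g y : R) :
  gaussian_rv P Y -> (sqrte 'E_P[fun w => (Y w ^+ 2)%R] <= g%:E)%E -> 0 <= y ->
  (P [set w | (y * g < `|Y w|)%R] <= (2 * expR (2^-1 - y ^+ 2 / 2))%:E)%E.
Proof.
move=> [mY [m [s [s0 lawY]]]] hg y0.
have g0 : 0 <= g by rewrite -lee_fin (le_trans _ hg)// sqrte_ge0.
have ms : m ^+ 2 + s ^+ 2 <= g ^+ 2.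
  have := law_second_moment_ge _ _ _ _ _ _ _ mY s0 lawY; rewrite -lee_fin => /le_trans; apply.
  have E0 : (0 <= 'E_P[fun w => (Y w ^+ 2)%R])%E.
    by apply: expectation_ge0 => w; exact: sqr_ge0.
  rewrite -(sqr_sqrte E0) EFin_expe.
  by rewrite !expe2; apply: lee_pmul => //; exact: sqrte_ge0.
have PE A : measurable A -> P (Y @^-1` A) = gaussian_law m s A.
  by move=> /lawY.
(* The Chernoff parameter [y / g] requires [g != 0]; for [g = 0] the law is the Dirac mass at 0. *)
have [gE0|gN0] := eqVneq g 0.
  have [m0 s00] : m = 0 /\ s = 0.
    move: ms; rewrite gE0 expr0n/= => ms.
    have := sqr_ge0 m; have := sqr_ge0 s => h1 h2.
    by split; apply/eqP; rewrite -sqrf_eq0; apply/eqP; lra.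
  have -> : [set w | y * g < `|Y w|] = Y @^-1` (~` [set 0]).
    apply/seteqP; split=> w /=; rewrite gE0 mulr0 normr_gt0; first by move/eqP.
    by move=> /eqP.
  rewrite PE; last exact: measurableC.
  rewrite /gaussian_law s00 eqxx m0 diracE memNset//=.
  by rewrite lee_fin mulr_ge0// expR_ge0.
have gp : 0 < g by rewrite lt_def gN0.
have -> : [set w | y * g < `|Y w|] =
    Y @^-1` `]y * g, +oo[ `|` Y @^-1` `]-oo, - (y * g)[.
  apply/seteqP; split=> w /=; rewrite !in_itv/= ?andbT lter_normr ltrNr.
    by move=> /orP[]; [left|right].
  by move=> [->//|->]; rewrite orbT.
have mpre A : measurable A -> measurable (Y @^-1` A).
  by move=> mA; rewrite -[X in measurable X]setTI; exact: mY.
(* Only the square of [t] is prescribed, so that [y / g] and [- (y / g)] serve the upper and the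
   lower tail. *)
have ex t : t ^+ 2 = (y / g) ^+ 2 -> t * m + t ^+ 2 * s ^+ 2 / 2 - y ^+ 2 <= 2^-1 - y ^+ 2 / 2.
  move=> t2; rewrite -subr_ge0.
  have gg : g != 0 by [].
  have h : t ^+ 2 * s ^+ 2 <= y ^+ 2 - t ^+ 2 * m ^+ 2.
    have -> : y ^+ 2 = t ^+ 2 * g ^+ 2 by rewrite t2; field.
    by rewrite -mulrBr ler_wpM2l ?sqr_ge0// lerBrDl.
  have := sqr_ge0 (t * m - 1); lra.
have P1 : (P (Y @^-1` `](y * g)%R, +oo[) <= (expR (2^-1 - y ^+ 2 / 2))%:E)%E.
  rewrite PE//; apply: le_trans (@gaussian_law_chernoff _ m s (y / g) (y ^+ 2) _ _ _) _ => //.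
    move=> x /=; rewrite in_itv/= andbT => /ltW h.
    have -> : y ^+ 2 = y / g * (y * g) by field.
    by rewrite ler_wpM2l// divr_ge0.
  by rewrite lee_fin ler_expR ex.
have P2 : (P (Y @^-1` `]-oo, (- (y * g))%R[) <= (expR (2^-1 - y ^+ 2 / 2))%:E)%E.
  rewrite PE//; apply: le_trans (@gaussian_law_chernoff _ m s (- (y / g)) (y ^+ 2) _ _ _) _ => //.
    move=> x /=; rewrite in_itv/= => /ltW h.
    have -> : y ^+ 2 = - (y / g) * (- (y * g)) by field.
    by rewrite ler_wnM2l// oppr_le0 divr_ge0.
  by rewrite lee_fin ler_expR ex// sqrrN.
apply: (le_trans (measureU2 _ _ _)); [exact: mpre|exact: mpre|].
by rewrite -[2]/(1 + 1) mulrDl mul1r EFinD; exact: leeD.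
Qed.

(** * Chaining and Fernique's inequality *)

(** Let p_n be t rounded down to the n-th grid. Both p_n and p_(n+1) lie within 1/N_n below t, so
    consecutive points form an admissible pair and |f(p_n)| telescopes; continuity passes the bound
    to t. *)
Lemma chaining_bound (R : realType) (f : R -> R) (N : nat -> nat) (b : nat -> R)
    (b0 B : R) :
  {within `[0, 1], continuous f} ->
  (forall n, (n < N n)%N) -> (forall n, (N n <= N n.+1)%N) ->
  (forall k, (k <= N 0)%N -> `|f (k%:R / (N 0)%:R)| <= b0) ->
  (forall n j k, (j <= N n.+1)%N -> (k <= N n)%N ->
    `|j%:R / (N n.+1)%:R - k%:R / (N n)%:R| <= (N n)%:R^-1 :> R ->
    `|f (j%:R / (N n.+1)%:R) - f (k%:R / (N n)%:R)| <= b n) ->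
  (forall n, \sum_(i < n) b i <= B) ->
  forall t, t \in `[0, 1] -> `|f t| <= b0 + B.
Proof.
move=> cf ltN leN hb0 hb hB t t01.
have /andP[t0 t1] : 0 <= t <= 1 by move: t01; rewrite in_itv.
have N0 n : 0 < (N n)%:R :> R by rewrite ltr0n (leq_ltn_trans _ (ltN n)).
pose q n := Num.truncn (t * (N n)%:R).
pose p n : R := (q n)%:R / (N n)%:R.
have tN0 n : 0 <= t * (N n)%:R by rewrite mulr_ge0// ltW.
have qitv n : (q n)%:R <= t * (N n)%:R < (q n).+1%:R by exact: truncn_itv.
have ptl n : p n <= t by rewrite ler_pdivrMr//; have /andP[] := qitv n.
have ptu n : t - (N n)%:R^-1 < p n.
  rewrite ltrBlDr -[X in _ + X]mul1r -mulrDl natr1 ltr_pdivlMr//.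
  by have /andP[] := qitv n.
have p0 n : 0 <= p n by rewrite divr_ge0.
have qN n : (q n <= N n)%N.
  have /andP[h _] := qitv n; rewrite -(ler_nat R) (le_trans h)//.
  by rewrite ler_piMl// ltW.
have fp n : `|f (p n)| <= b0 + \sum_(i < n) b i.
  elim: n => [|n ih]; first by rewrite big_ord0 addr0 hb0.
  rewrite big_ord_recr/= addrA.
  have -> : f (p n.+1) = f (p n) + (f (p n.+1) - f (p n)) by rewrite addrC subrK.
  rewrite (le_trans (ler_normD _ _))// lerD// hb//.
  have := ptl n; have := ptl n.+1; have := ptu n; have := ptu n.+1 => h1 h2 h3 h4.
  have h5 : (N n.+1)%:R^-1 <= (N n)%:R^-1 :> R by rewrite lef_pV2 ?posrE// ler_nat.
  by rewrite -/(p n) -/(p n.+1) ler_norml; lra.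
rewrite leNgt; apply/negP => ft.
have e0 : 0 < `|f t| - (b0 + B) by lra.
move/subspace_continuousP : cf => /(_ t); rewrite /= => /(_ t01).
move/cvgrPdist_lt => /(_ _ e0); rewrite /within/=.
move=> /nbhs_ballP[del /= del0 hdel].
(* The mesh tends to 0 because [n < N n]. *)
have [n nd] : exists n, (N n)%:R^-1 < del.
  exists (Num.truncn (del^-1)); rewrite -[ltRHS]invrK ltf_pV2 ?posrE ?invr_gt0//.
  have dV0 : 0 <= del^-1 by rewrite invr_ge0 ltW.
  have /andP[_ h] := truncn_itv dV0.
  by rewrite (lt_le_trans h)// ler_nat.
have := hdel (p n); rewrite /ball/= => /(_ _ _)/wrap[].
- by rewrite ger0_norm ?subr_ge0//; have := ptu n; lra.
- by rewrite in_itv/= p0/= (le_trans (ptl n)).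
have h1 : `|f t| <= `|f t - f (p n)| + `|f (p n)|.
  by rewrite -{1}(subrK (f (p n)) (f t)) ler_normD.
have := fp n; have := hB n => h2 h3 h4.
have : `|f t - f (p n)| < `|f t| - (b0 + B) by exact: h4.
lra.
Qed.

Lemma measure_bigsetU_le_cst (R : realType) (d : measure_display)
    (T : measurableType d) (P : probability T R) (F : nat -> set T) (n : nat)
    (c : R) :
  (forall k, measurable (F k)) -> (forall k, (k < n)%N -> P (F k) <= c%:E)%E ->
  (P (\big[setU/set0]_(k < n) F k) <= (n%:R * c)%:E)%E.
Proof.
move=> mF PF; apply: (le_trans (Boole_inequality _ _)) => //.
apply: (@le_trans _ _ (\sum_(k < n) c%:E)%E).
  by apply: lee_sum => k _; exact: PF.
by rewrite sumEFin sumr_const card_ord mulr_natl.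
Qed.

Lemma gaussian_process_marginal (R : realType) (d : measure_display)
    (T : measurableType d) (P : probability T R) (X : R -> T -> R) (t : R) :
  gaussian_process P X -> t \in `[0, 1] -> gaussian_rv P (X t).
Proof.
move=> gX t01; have := gX 1%N (fun=> t) (fun=> 1) (fun=> t01).
by congr gaussian_rv; apply/funext => w; rewrite big_ord1 mul1r.
Qed.

Lemma gaussian_process_increment (R : realType) (d : measure_display)
    (T : measurableType d) (P : probability T R) (X : R -> T -> R) (s t : R) :
  gaussian_process P X -> s \in `[0, 1] -> t \in `[0, 1] ->
  gaussian_rv P (fun w => X t w - X s w).
Proof.
move=> gX s01 t01.
have := gX 2%N (fun k => if k == ord0 then t else s)
  (fun k => if k == ord0 then 1 else -1) _.
move=> /(_ (fun k => _))/wrap[]; first by move=> k; case: ifP.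
by congr gaussian_rv; apply/funext => w; rewrite big_ord_recl big_ord1/= mul1r mulN1r.
Qed.

(** Each level squares the previous one. Base 4 is an integer above e, so the mesh is at most
    exp(-s^2) at s = sqrt(2)^(n+1). *)
Definition grid (n : nat) : nat := 4 ^ (2 ^ n.+1).

Lemma grid_gt0 n : (0 < grid n)%N. Proof. by rewrite expn_gt0. Qed.

Lemma ltn_grid n : (n < grid n)%N.
Proof.
apply: (@leq_trans (2 ^ n.+1)).
  by apply: ltnW; exact: ltn_expl.
by apply: ltnW; exact: ltn_expl.
Qed.

Lemma leq_grid n : (grid n <= grid n.+1)%N.
Proof. by rewrite leq_exp2l// leq_exp2l. Qed.

Lemma grid_in01 (R : realType) (n k : nat) : (k <= grid n)%N ->
  (k%:R / (grid n)%:R : R) \in `[0, 1].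
Proof.
move=> kn; have g0 : 0 < (grid n)%:R :> R by rewrite ltr0n grid_gt0.
by rewrite in_itv/= divr_ge0//= ler_pdivrMr// mul1r ler_nat.
Qed.

(** Here [q] stands for exp(-x^2/2). With m = 2^(n+1) the two grids have sizes 16^m and 4^m, so the
    left side is at most 4 (64 q)^m. As 64 q <= 1/2 and m - 1 >= n + 1, all factors but one together
    give at most 2^-(n+1). *)
Lemma grid_pairs_le (R : realType) (n : nat) (q : R) : 0 <= q -> q <= (128)^-1 ->
  ((grid n.+1).+1%:R * ((grid n).+1%:R * q ^+ (2 ^ n.+1))) <= 256 * q / 2 ^+ n.+1.
Proof.
move=> q0 q1.
have S k : (grid k).+1%:R <= 2 * (grid k)%:R :> R.
  by rewrite -natrM ler_nat mul2n -addnn -addn1 leq_add2l grid_gt0.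
set m := (2 ^ n.+1)%N.
apply: (@le_trans _ _ (2 * (grid n.+1)%:R * (2 * (grid n)%:R * q ^+ m))).
  apply: ler_pM => //; first by rewrite mulr_ge0// exprn_ge0.
  by apply: ler_pM => //; rewrite exprn_ge0.
have -> : 2 * (grid n.+1)%:R * (2 * (grid n)%:R * q ^+ m) = 4 * (64 * q) ^+ m :> R.
  rewrite /grid -/m expnS -/m mulnC expnM !natrX.
  have -> : (64 : R) = 4 ^+ 2 * 4 by rewrite -natrX -natrM.
  rewrite !exprMn.
  ring.
have mn : (n.+2 <= m)%N by rewrite /m; exact: ltn_expl.
have -> : m = m.-1.+1 by rewrite prednK// (leq_trans _ mn).
rewrite exprS.
have -> : 256 * q / 2 ^+ n.+1 = 4 * (64 * q * (2^-1) ^+ n.+1).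
  by rewrite exprVn; field; rewrite expf_neq0.
have q2 : 64 * q <= 2^-1 by lra.
have q3 : 0 <= 64 * q by lra.
rewrite ler_pM2l// ler_wpM2l//.
apply: (@le_trans _ _ ((2^-1) ^+ m.-1)); first by rewrite lerXn2r ?nnegrE//; lra.
apply: ler_wiXn2l; [lra|lra|].
by rewrite -ltnS prednK// (leq_trans _ mn).
Qed.

(* 2^10 e^(1/2) = (2 e^(1/2)) * 256 * 2: the constant of gaussian_rv_tail, the
   bound of grid_pairs_le on the first level, and the sum of 2^-n over the levels. *)
Lemma chaining_event (R : realType) (d : measure_display)
    (T : measurableType d) (P : probability T R) (X : R -> T -> R)
    (g : nat -> R) (G x : R) :
  gaussian_process P X -> 0 <= x -> expR (- (x ^+ 2 / 2)) <= (128)^-1 ->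
  (forall t : R, t \in `[0%R, 1%R] ->
    sqrte 'E_P[fun w => (X t w ^+ 2)%R] <= G%:E)%E ->
  (forall n (s t : R), s \in `[0%R, 1%R] -> t \in `[0%R, 1%R] ->
    (`|t - s| <= (grid n)%:R^-1)%R ->
    sqrte 'E_P[fun w => (`|X t w - X s w| ^+ 2)%R] <= (g n)%:E)%E ->
  exists A : set T, [/\ measurable A,
    (P A <= (2 ^+ 10 * expR 2^-1 * expR (- (x ^+ 2 / 2)))%:E)%E &
    forall w, ~ A w ->
      (forall k, (k <= grid 0)%N -> `|X (k%:R / (grid 0)%:R) w| <= x * G) /\
      (forall n j k, (j <= grid n.+1)%N -> (k <= grid n)%N ->
        `|j%:R / (grid n.+1)%:R - k%:R / (grid n)%:R| <= (grid n)%:R^-1 :> R ->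
        `|X (j%:R / (grid n.+1)%:R) w - X (k%:R / (grid n)%:R) w| <=
          x * Num.sqrt 2 ^+ n.+1 * g n)].
Proof.
move=> gX x0 q1 hG hg; set q := expR _ in q1 *.
have q0 : 0 <= q by exact: expR_ge0.
pose dX n j k w := X (j%:R / (grid n.+1)%:R) w - X (k%:R / (grid n)%:R) w.
pose near_pts n j k := `|j%:R / (grid n.+1)%:R - k%:R / (grid n)%:R| <= (grid n)%:R^-1 :> R.
(* Inadmissible index pairs get the empty set, so the unions below can run over all pairs. *)
pose S n j k : set T := if (j <= grid n.+1)%N && (k <= grid n)%N && near_pts n j k then
   [set w | x * Num.sqrt 2 ^+ n.+1 * g n < `|dX n j k w| ] else set0.
pose S0 k : set T := if (k <= grid 0)%N then
   [set w | x * G < `|X (k%:R / (grid 0)%:R) w| ] else set0.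
have mlt (c : R) (Y : T -> R) : gaussian_rv P Y -> measurable [set w | c < `|Y w|].
  move=> [mY _].
  have mnY : measurable_fun [set: T] (fun w => `|Y w|) by exact: measurableT_comp.
  have := mnY measurableT [set` `]c, +oo[] (measurable_itv _).
  rewrite setTI; congr (measurable _); apply/seteqP.
  by split=> w /=; rewrite in_itv/= andbT.
have grv n j k : (j <= grid n.+1)%N -> (k <= grid n)%N -> gaussian_rv P (dX n j k).
  by move=> jn kn; apply: gaussian_process_increment => //; exact: grid_in01.
have grv0 k : (k <= grid 0)%N -> gaussian_rv P (X (k%:R / (grid 0)%:R)).
  by move=> k0; apply: gaussian_process_marginal => //; exact: grid_in01.
have mS n j k : measurable (S n j k).
  rewrite /S; case: ifP => // /andP[/andP[jn kn] _].
  by apply: mlt; exact: grv.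
have mS0 k : measurable (S0 k).
  by rewrite /S0; case: ifP => // k0; apply: mlt; exact: grv0.
have PS n j k : (P (S n j k) <= (2 * expR 2^-1 * q ^+ (2 ^ n.+1))%:E)%E.
  rewrite /S; case: ifP => [/andP[/andP[jn kn] nr]|_]; last first.
    by rewrite measure0 lee_fin !mulr_ge0// ?exprn_ge0// expR_ge0.
  apply: (le_trans (gaussian_rv_tail _ _ _ _ (dX n j k) (g n) (x * Num.sqrt 2 ^+ n.+1) _ _ _)).
  - exact: grv.
  - have := hg n _ _ (grid_in01 R _ _ kn) (grid_in01 R _ _ jn) nr.
    suff -> : (fun w => `|X (j%:R / (grid n.+1)%:R) w - X (k%:R / (grid n)%:R) w| ^+ 2) =
      (fun w => dX n j k w ^+ 2) by [].
    by apply/funext => w; rewrite real_normK ?num_real.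
  - by rewrite mulr_ge0// exprn_ge0// sqrtr_ge0.
  rewrite lee_fin expRD mulrA ler_wpM2l ?mulr_ge0 ?expR_ge0//.
  (* The squared threshold is x^2 2^(n+1), which turns the tail bound into [q ^+ (2 ^ n.+1)]. *)
  rewrite /q -expRM_natl ler_expR natrX exprMn -exprM mulnC exprM sqr_sqrtr//.
  by rewrite le_eqVlt; apply/orP; left; apply/eqP; field.
have PS0 k : (P (S0 k) <= (2 * expR 2^-1 * q)%:E)%E.
  rewrite /S0; case: ifP => [k0|_]; last first.
    by rewrite measure0 lee_fin !mulr_ge0// expR_ge0.
  apply: (le_trans (gaussian_rv_tail _ _ _ _ _ G x (grv0 _ k0) _ x0)).
    exact/hG/grid_in01.
  by rewrite lee_fin expRD mulrA.
(* Level 0 controls the values on the coarsest grid; level [m.+1] controls the increments from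
   [grid m] to [grid m.+1]. *)
pose F n : set T := if n is m.+1 then
    \big[setU/set0]_(j < (grid m.+1).+1) \big[setU/set0]_(k < (grid m).+1) S m j k
  else \big[setU/set0]_(k < (grid 0).+1) S0 k.
have mF n : measurable (F n).
  case: n => [|n]; first exact: bigsetU_measurable.
  by apply: bigsetU_measurable => j _; exact: bigsetU_measurable.
have PF n : (P (F n) <= (2 ^+ 10 * expR 2^-1 * q / (2 ^ n.+1)%:R)%:E)%E.
  case: n => [|n] /=.
    apply: (le_trans (measure_bigsetU_le_cst _ _ _ _ _ _ (2 * expR 2^-1 * q) _ _)) => //.
    have e0 := mulr_ge0 (expR_ge0 (2^-1 : R)) q0.
    rewrite lee_fin /grid.
    (* The coarsest grid has 17 points, and 17 * 2 is below 2^10 / 2. *)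
    have -> : (4 ^ 2 ^ 1).+1%:R = 17 :> R by [].
    by rewrite expn1; lra.
  apply: le_trans.
    apply: (measure_bigsetU_le_cst _ _ _ P
      (fun j => \big[setU/set0]_(k < (grid n).+1) S n j k) _
      ((grid n).+1%:R * (2 * expR 2^-1 * q ^+ (2 ^ n.+1)))).
      by move=> j; exact: bigsetU_measurable.
    by move=> j _; apply: measure_bigsetU_le_cst.
  rewrite lee_fin.
  have -> : (grid n.+1).+1%:R * ((grid n).+1%:R * (2 * expR 2^-1 * q ^+ (2 ^ n.+1))) =
    2 * expR 2^-1 * ((grid n.+1).+1%:R * ((grid n).+1%:R * q ^+ (2 ^ n.+1))) by ring.
  have -> : 2 ^+ 10 * expR 2^-1 * q / (2 ^ n.+2)%:R = 2 * expR 2^-1 * (256 * q / 2 ^+ n.+1).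
    by rewrite natrX (exprS _ n.+1); field; rewrite expf_neq0.
  by rewrite ler_wpM2l ?mulr_ge0 ?expR_ge0// grid_pairs_le.
exists (\bigcup_n F n); split.
- exact: bigcup_measurable.
- apply: (le_trans (generalized_Boole_inequality _ _ _)) => //.
    exact: bigcup_measurable.
  apply: (le_trans (lee_nneseries _ _)); last first.
  + apply: (epsilon_trick0 predT).
    exact: mulr_ge0 (mulr_ge0 (exprn_ge0 _ (ler0n _ 2)) (expR_ge0 _)) q0.
  + by move=> n _; exact: PF.
  + by [].
- move=> w nAw; split=> [k k0|n j k jn kn nr]; rewrite leNgt; apply/negP => h; apply: nAw.
    exists 0%N => //; rewrite /F/= -bigcup_mkord; exists k => //=.
    by rewrite /S0 k0.
  exists n.+1 => //; rewrite /F/=.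
  rewrite -(bigcup_mkord _ (fun j => \big[setU/set0]_(k < (grid n).+1) S n j k)).
  by exists j => //=; rewrite -bigcup_mkord; exists k => //=; rewrite /S jn kn /near_pts nr.
Qed.

(** The sets where [f] exceeds a level are initial segments of [D], hence intervals. *)
Lemma antitone_measurable (R : realType) (D : set R) (f : R -> \bar R) :
  is_interval D -> (forall x y, D x -> D y -> x <= y -> (f y <= f x)%E) ->
  measurable_fun D f.
Proof.
move=> iD fD mD; apply: (measurability _ (ErealGenOInfty.measurableE R)) => //.
move=> /= _ [_ [y ->]] <-; rewrite preimage_itvoy.
apply: is_interval_measurable => a b /= [Da fa] [Db fb] c acb.
have Dc : D c by exact: iD acb.
by split=> //; apply: (lt_le_trans fb); apply: fD => //; have /andP[] := acb.
Qed.

(** Each term is the integral over one half-open cell of the value at its right end, which is the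
    least on the cell. *)
Lemma antitone_sum_le_integral (R : realType) (f : R -> \bar R) (a : R)
    (u : nat -> R) (n : nat) :
  (forall x y, a <= x -> x <= y -> (f y <= f x)%E) ->
  (forall x, a <= x -> (0 <= f x)%E) ->
  u 0%N = a -> (forall i, u i <= u i.+1) ->
  (\sum_(i < n) (u i.+1 - u i)%:E * f (u i.+1) <=
    \int[lebesgue_measure]_(x in `[a, +oo[) f x)%E.
Proof.
move=> fa f0 u0 ui.
have au i : a <= u i by elim: i => [|i ih]; rewrite ?u0// (le_trans ih).
have mf : measurable_fun [set` `[a, +oo[] f.
  apply: antitone_measurable; first exact: interval_is_interval.
  by move=> x y /=; rewrite !in_itv/= !andbT => ax _; exact: fa.
have mfS (D : set R) : D `<=` [set` `[a, +oo[] -> measurable_fun D f.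
  by move=> DS; exact: measurable_funS mf.
apply: (@le_trans _ _ (\int[lebesgue_measure]_(x in `[a, u n]) f x)%E); last first.
  apply: ge0_subset_integral => //.
    by move=> x /=; rewrite in_itv/= andbT; exact: f0.
  by move=> x /=; rewrite !in_itv/= andbT => /andP[].
elim: n => [|n ih].
  rewrite big_ord0; apply: integral_ge0 => x /=.
  by rewrite in_itv/= => /andP[ax _]; exact: f0.
rewrite big_ord_recr/=.
have -> : [set` `[a, u n.+1]] = [set` `[a, u n]] `|` [set` `]u n, u n.+1]].
  apply/seteqP; split => x /=; rewrite !in_itv/=.
    move=> /andP[ax xu]; have [xn|nx] := leP x (u n); [left|right] => //.
    by rewrite ax.
  move=> [/andP[-> /le_trans->]//|/andP[/ltW h ->]].
  by rewrite (le_trans _ h).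
have uS : [set` `[a, u n]] `|` [set` `]u n, u n.+1]] `<=` [set` `[a, +oo[].
  move=> x [] /=; rewrite !in_itv/= andbT => /andP[h _] //.
  by rewrite (le_trans (au n))// ltW.
rewrite ge0_integral_setU//; last 3 first.
- exact: mfS.
- by move=> x /uS /=; rewrite in_itv/= andbT; exact: f0.
- apply/disj_setPS => x /= []; rewrite !in_itv/= => /andP[_ h1] /andP[h2 _].
  by move: h2; rewrite ltNge h1.
apply: leeD => //.
have [->|nun] := eqVneq (u n) (u n.+1).
  rewrite subrr mul0e; apply: integral_ge0 => x /=.
  by rewrite in_itv/= => /andP[h1 h2]; move: h1; rewrite ltNge h2.
have un : u n < u n.+1 by rewrite lt_neqAle nun ui.
have -> : ((u n.+1 - u n)%:E * f (u n.+1) =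
   \int[lebesgue_measure]_(x in `]u n, u n.+1]) (cst (f (u n.+1)) x))%E.
  by rewrite integral_cst//= lebesgue_measure_itv/= lte_fin un muleC.
apply: ge0_le_integral => //.
- by move=> x _; exact: f0.
- by apply: mfS => x h; apply: uS; right.
- move=> x /=; rewrite in_itv/= => /andP[h1 h2]; apply: fa => //.
  by rewrite (le_trans (au n))// ltW.
Qed.

Lemma phi_ge0 (R : realType) (d : measure_display) (T : measurableType d)
    (P : probability T R) (X : R -> T -> R) (r : R) :
  0 <= r -> (0 <= phi P X r)%E.
Proof.
move=> r0; apply: (le_trans (sqrte_ge0 _)); apply: ereal_sup_ubound.
exists 0, 0; split; last reflexivity.
- by rewrite in_itv/= lexx ler01.
- by rewrite in_itv/= lexx ler01.
- by rewrite subrr normr0.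
Qed.

(** Right-endpoint sum along the nodes sqrt(2)^i. The constant 2 + sqrt(2) is the ratio of
    sqrt(2)^(i+1) to the cell length sqrt(2)^(i+1) - sqrt(2)^i. *)
Lemma sum_increments_le_phi_integral (R : realType) (d : measure_display)
    (T : measurableType d) (P : probability T R) (X : R -> T -> R) (n : nat) :
  (\sum_(i < n) (Num.sqrt 2 ^+ i.+1)%:E * phi P X (expR (- (Num.sqrt 2 ^+ i.+1) ^+ 2)%R) <=
    (2 + Num.sqrt 2)%:E *
    \int[lebesgue_measure]_(s in `[1%R, +oo[) phi P X (expR (- s ^+ 2)%R))%E.
Proof.
have phi_le (r r' : R) : r <= r' -> (phi P X r <= phi P X r')%E.
  move=> rr; apply: ereal_sup_le => y [s [t [s01 t01 st ->]]].
  by exists s, t; split => //; exact: le_trans rr.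
have s2 : Num.sqrt 2 ^+ 2 = 2 :> R by rewrite sqr_sqrtr.
have s1 : 1 <= Num.sqrt 2 :> R by rewrite -[leLHS]sqrtr1 ler_wsqrtr// ler1n.
have := antitone_sum_le_integral R (fun s : R => phi P X (expR (- s ^+ 2))) 1
  (fun i => Num.sqrt 2 ^+ i) n _ _ _ _.
move=> /(_ _ _ _ _)/wrap[].
- move=> x y x1 xy; apply: phi_le; rewrite ler_expR lerN2.
  by rewrite lerXn2r// nnegrE; lra.
- by move=> x _; exact/phi_ge0/expR_ge0.
- by rewrite expr0.
- by move=> i; rewrite exprS ler_peMl// exprn_ge0// sqrtr_ge0.
move=> h.
have c0 : (0 <= (2 + Num.sqrt 2 : R)%:E)%E by rewrite lee_fin addr_ge0// sqrtr_ge0.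
apply: (le_trans _ (lee_wpmul2l c0 h)).
rewrite ge0_sume_distrr; last first.
  move=> i _; apply: mule_ge0; last by exact/phi_ge0/expR_ge0.
  by rewrite lee_fin exprS subr_ge0 ler_peMl// exprn_ge0// sqrtr_ge0.
apply: lee_sum => i _; rewrite muleA -EFinM.
suff -> : (2 + Num.sqrt 2) * (Num.sqrt 2 ^+ i.+1 - Num.sqrt 2 ^+ i) = Num.sqrt 2 ^+ i.+1 :> R by [].
have -> : (2 + Num.sqrt 2) * (Num.sqrt 2 ^+ i.+1 - Num.sqrt 2 ^+ i) =
  Num.sqrt 2 ^+ i * (Num.sqrt 2 ^+ 2 - 2 + Num.sqrt 2) :> R by rewrite exprS; ring.
by rewrite s2 subrr add0r exprSr.
Qed.

(** Amounts to e <= 4, which follows from exp(-1/2) >= 1 - 1/2. It lets [phi] at exp(-s^2) control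
    increments over one mesh. *)
Lemma inv_grid_le_expR (R : realType) n :
  (grid n)%:R^-1 <= expR (- (Num.sqrt 2 ^+ n.+1) ^+ 2) :> R.
Proof.
have e4 : expR 1 <= 4 :> R.
  have h : expR (2^-1) <= 2 :> R.
    rewrite -[leRHS]invrK -[leLHS]invrK lef_pV2 ?posrE ?invr_gt0 ?expR_gt0//.
    by rewrite -expRN; apply: le_trans (expR_ge1Dx _); lra.
  have -> : expR 1 = expR 2^-1 ^+ 2 :> R by rewrite -expRM_natl mulfV.
  have -> : (4 : R) = 2 ^+ 2 by rewrite -natrX.
  by rewrite lerXn2r// nnegrE// expR_ge0.
rewrite -exprM mulnC exprM sqr_sqrtr// -natrX expRN lef_pV2 ?posrE ?expR_gt0 ?ltr0n ?grid_gt0//.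
rewrite -[_%:R]mulr1 expRM_natl /grid natrX.
by rewrite lerXn2r// nnegrE// expR_ge0.
Qed.

(** A single exceptional event serves all times, so the events of different coordinates can simply
    be united. *)
Lemma fernique (R : realType) (d : measure_display)
    (T : measurableType d) (P : probability T R) (X : R -> T -> R) (D x : R) :
  gaussian_process P X -> continuous_process X -> delta P X = D%:E ->
  0 <= x -> expR (- (x ^+ 2 / 2)) <= (128)^-1 ->
  exists A : set T, [/\ measurable A,
    (P A <= (2 ^+ 10 * expR 2^-1 * expR (- (x ^+ 2 / 2)))%:E)%E &
    forall w, ~ A w -> forall t, t \in `[0, 1] -> `|X t w| <= x * D].
Proof.
move=> gX cX DE x0 qx.
have Gamma_ge t : t \in `[0, 1] -> (sqrte 'E_P[fun w => (X t w ^+ 2)%R] <= Gamma P X)%E.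
  by move=> t01; apply: ereal_sup_ubound; exists t.
have G0 : (0 <= Gamma P X)%E.
  apply: (le_trans (sqrte_ge0 _) (Gamma_ge 0 _)).
  by rewrite in_itv/= lexx ler01.
have phin n := sum_increments_le_phi_integral _ _ _ P X n.
move: DE; rewrite /delta; move: phin; set J := (_ * _)%E => phin DE.
have J0 : (0 <= J)%E by have := phin 0%N; rewrite big_ord0.
have [Gf Jf] : Gamma P X \is a fin_num /\ J \is a fin_num.
  have : Gamma P X + J \is a fin_num by rewrite DE.
  by rewrite fin_numD => /andP[].
pose G := fine (Gamma P X); pose j := fine J.
have GE : Gamma P X = G%:E by rewrite fineK.
have JE : J = j%:E by rewrite fineK.
have DGj : D = G + j by apply: EFin_inj; rewrite -DE EFinD -GE -JE.
pose psi n := phi P X (expR (- (Num.sqrt 2 ^+ n.+1) ^+ 2)).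
have psi0 n : (0 <= psi n)%E by exact/phi_ge0/expR_ge0.
have s2 (n : nat) : 0 < Num.sqrt 2 ^+ n :> R by rewrite exprn_gt0// sqrtr_gt0.
(* A positive multiple of [psi n] is one term of a sum bounded by the finite [J]. *)
have psif n : psi n \is a fin_num.
  have := phin n.+1; rewrite big_ord_recr/= -/(psi n) => h.
  have : ((Num.sqrt 2 ^+ n.+1)%:E * psi n <= j%:E)%E.
    rewrite -JE; apply: le_trans h; rewrite leeDr//.
    by apply: sume_ge0 => i _; apply: mule_ge0; [rewrite lee_fin ltW|exact: psi0].
  move=> {}h; rewrite ge0_fin_numE// ltNge leye_eq; apply/negP => /eqP E.
  by move: h; rewrite E gt0_muley ?lte_fin//.
pose g n := fine (psi n).
have gE n : psi n = (g n)%:E by rewrite fineK.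
have [A [mA PA hA]] := chaining_event R d T P X g G x gX x0 qx
  (fun t t01 => ltac:(by rewrite -GE; exact: Gamma_ge))
  (fun n s t s01 t01 st => ltac:(
     by rewrite -gE; apply: ereal_sup_ubound; exists s, t; split => //;
        rewrite distrC (le_trans st)// inv_grid_le_expR)).
exists A; split => // w /hA[h1 h2] t t01.
rewrite DGj mulrDr.
apply: (chaining_bound R (X ^~ w) grid (fun n => x * Num.sqrt 2 ^+ n.+1 * g n)) => //.
- exact: ltn_grid.
- exact: leq_grid.
- move=> n; under eq_bigr do rewrite -mulrA.
  rewrite -mulr_sumr ler_wpM2l// -lee_fin -JE -sumEFin.
  apply: le_trans (phin n); rewrite le_eqVlt; apply/orP; left; apply/eqP.
  by apply: eq_bigr => i _; rewrite EFinM -gE.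
Qed.

(** * Orthonormal bases and measurability of the supremum *)

Lemma unit_grid_point (R : realType) (n : nat) (t : R) : t \in `[0, 1] ->
  exists2 k, (k <= n.+1)%N & k%:R / n.+1%:R <= t < k%:R / n.+1%:R + n.+1%:R^-1.
Proof.
rewrite in_itv/= => /andP[t0 t1].
have n0 : 0 < n.+1%:R :> R by rewrite ltr0n.
have tn0 : 0 <= t * n.+1%:R by rewrite mulr_ge0// ltW.
have /andP[h1 h2] := truncn_itv tn0.
exists (Num.truncn (t * n.+1%:R)).
  by rewrite -(ler_nat R) (le_trans h1)// ler_piMl// ltW.
rewrite ler_pdivrMr// h1/=.
by rewrite -[X in _ + X]mul1r -mulrDl natr1 ltr_pdivlMr.
Qed.

(** Strict superlevel sets are relatively open, so countably many times detect them; this is what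
    makes the supremum measurable. *)
Lemma within_continuous_gt_grid (R : realType) (f : R -> R) (c t : R) :
  {within `[0, 1], continuous f} -> t \in `[0, 1] -> c < f t ->
  exists n k, (k <= n.+1)%N /\ c < f (k%:R / n.+1%:R).
Proof.
move=> cf t01 cft.
have e0 : 0 < f t - c by rewrite subr_gt0.
move/subspace_continuousP : cf => /(_ t); rewrite /= => /(_ t01).
move/cvgrPdist_lt => /(_ _ e0); rewrite /within/= => /nbhs_ballP[del /= del0 hdel].
have dV0 : 0 <= del^-1 by rewrite invr_ge0 ltW.
have /andP[_ h] := truncn_itv dV0.
pose n := Num.truncn del^-1.
have nd : n.+1%:R^-1 < del.
  by rewrite -[ltRHS]invrK ltf_pV2 ?posrE ?invr_gt0// (lt_le_trans h).
have [k kn /andP[k1 k2]] := unit_grid_point R n t t01.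
exists n, k; split => //.
have k01 : k%:R / n.+1%:R \in `[0, 1 : R].
  by rewrite in_itv/= divr_ge0//= ler_pdivrMr// mul1r ler_nat.
have := hdel (k%:R / n.+1%:R); rewrite /ball/= => /(_ _ k01)/wrap[].
  by rewrite ger0_norm ?subr_ge0// (lt_trans _ nd)// ltrBlDl.
move=> h3; have : `|f t - f (k%:R / n.+1%:R)| < f t - c by exact: h3.
by move=> /ltr_normlW; lra.
Qed.

Section orthonormal.
Variables (R : realType) (H : completeNormedModType R) (dot : {dot H for idfun}).
Hypothesis Hdot : norm_induced_by dot.
Variables (I : countType) (e : I -> H).

Lemma dotC (u v : H) : dot u v = dot v u.
Proof. by rewrite (hermC dot) expr0 mul1r. Qed.

Lemma sqr_normD_ortho (u v : H) : dot u v = 0 -> `|u + v| ^+ 2 = `|u| ^+ 2 + `|v| ^+ 2.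
Proof. by move=> uv; rewrite !Hdot hnormDd. Qed.

Hypothesis He : orthonormal_basis dot e.

Definition span_proj (s : seq I) (x : H) : H := \sum_(i <- s) dot x (e i) *: e i.

Lemma dot_sum_basis (s : seq I) (c : I -> R) (j : I) : uniq s ->
  dot (e j) (\sum_(i <- s) c i *: e i) = if j \in s then c j else 0.
Proof.
move=> us; rewrite linear_sumr.
under eq_bigr do rewrite linearZr_LR/= (proj1 He).
case: ifPn => js.
  rewrite (bigD1_seq j)//= eqxx mulr1 big1 ?addr0// => i ij.
  by rewrite eq_sym (negbTE ij) mulr0.
rewrite big_seq big1// => i iS; case: eqVneq => [ji|]; last by rewrite mulr0.
by move: js; rewrite ji iS.
Qed.

Lemma dot_residual (s : seq I) (x : H) (j : I) : uniq s -> j \in s ->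
  dot (x - span_proj s x) (e j) = 0.
Proof.
by move=> us js; rewrite dotC linearBr/= dot_sum_basis// js dotC subrr.
Qed.

Lemma dot_residual_sum (s r : seq I) (x : H) (c : I -> R) : uniq s ->
  {subset r <= s} -> dot (x - span_proj s x) (\sum_(i <- r) c i *: e i) = 0.
Proof.
move=> us rs; rewrite linear_sumr big_seq big1// => i ir.
by rewrite linearZr_LR/= dot_residual ?mulr0// rs.
Qed.

Lemma sqr_norm_proj (s : seq I) (x : H) : uniq s ->
  `|span_proj s x| ^+ 2 = \sum_(i <- s) dot x (e i) ^+ 2.
Proof.
move=> us; rewrite Hdot {2}/span_proj linear_sumr [LHS]big_seq [RHS]big_seq.
apply: eq_bigr => i iS; rewrite linearZr_LR/= (dotC (span_proj s x)) dot_sum_basis// iS.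
by rewrite expr2.
Qed.

Lemma bessel (s : seq I) (x : H) : uniq s ->
  \sum_(i <- s) dot x (e i) ^+ 2 <= `|x| ^+ 2.
Proof.
move=> us; rewrite -sqr_norm_proj//.
have : dot (x - span_proj s x) (span_proj s x) = 0 by exact: dot_residual_sum.
by move=> /sqr_normD_ortho; rewrite subrK => ->; rewrite lerDr sqr_ge0.
Qed.

(** Parseval's identity through finite partial sums. One direction is Bessel's inequality; for the
    other, density gives a finite combination [z] closer to [x] than [|x| - a], and the projection
    [y] onto its index set is at least as close, so |y| > a. *)
Lemma norm_gtP (x : H) (a : R) : 0 <= a ->
  a < `|x| <-> exists2 s, uniq s & a ^+ 2 < \sum_(i <- s) dot x (e i) ^+ 2.
Proof.
move=> a0; split=> [ax|[s us h]]; last first.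
  by rewrite -(ltr_pXn2r (_ : 0 < 2)%N) ?nnegrE//; exact: lt_le_trans h (bessel _ _ us).
have d0 : 0 < `|x| - a by rewrite subr_gt0.
have [_ /(_ (ball x (`|x| - a)))] := He.
case=> [||z [xz [r [c zE]]]].
- by exists x; exact: ballxx.
- exact: ball_open.
exists (undup r); first exact: undup_uniq.
rewrite -sqr_norm_proj ?undup_uniq// ltr_pXn2r ?nnegrE//.
set y := span_proj _ x.
have us : uniq (undup r) by exact: undup_uniq.
have yz0 : dot (x - y) (y - z) = 0.
  rewrite linearBr/= zE !dot_residual_sum ?subrr// => i.
  by rewrite mem_undup.
(* Best approximation: Pythagoras for the orthogonal vectors x - y and y - z. *)
have xyz : `|x - y| <= `|x - z|.
  rewrite -(ler_pXn2r (_ : 0 < 2)%N) ?nnegrE//.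
  by rewrite -[x - z](subrKA y) (sqr_normD_ortho _ _ yz0) lerDl sqr_ge0.
move: xz; rewrite -ball_normE/= => xz.
have := ler_normD y (x - y); rewrite addrC subrK => h.
have : `|x - z| < `|x| - a by exact: xz.
lra.
Qed.

End orthonormal.

Lemma within_continuous_sum_sqr (R : realType) (I : Type) (s : seq I)
    (f : I -> R -> R) (A : set R) :
  (forall i, {within A, continuous (f i)}) ->
  {within A, continuous (fun t => \sum_(i <- s) f i t ^+ 2)}.
Proof.
move=> cf; elim: s => [|i s ih].
  under eq_fun do rewrite big_nil.
  by move=> t; exact: cvg_cst.
under eq_fun do rewrite big_cons.
move=> t; apply: cvgD; last exact: ih.
by apply: cvgM; exact: cf.
Qed.

(** For [a >= 0], the supremum exceeds [a] exactly when some finite partial sum of squared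
    coordinates exceeds a^2 at some rational grid time: a countable union. *)
Lemma measurable_sup_norm (R : realType) (d : measure_display) (T : measurableType d)
    (P : probability T R) (H : completeNormedModType R)
    (dot : {dot H for idfun}) (Hdot : norm_induced_by dot)
    (I : countType) (e : I -> H) (He : orthonormal_basis dot e)
    (gamma : R -> T -> H) :
  cylindrical_continuous_gaussian P dot e gamma ->
  measurable_fun [set: T] (sup_norm gamma).
Proof.
move=> Hg; apply: (measurability _ (ErealGenOInfty.measurableE R)) => //.
move=> /= _ [_ [a ->]] <-; rewrite preimage_itvoy setTI.
have [a0|a0] := ltP a 0.
  have -> : [set w | (a%:E < sup_norm gamma w)%E] = [set: T]; last exact: measurableT.
  apply/seteqP; split => // w _ /=.
  apply: (@lt_le_trans _ _ (`|gamma 0 w|)%:E).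
    by rewrite lte_fin (lt_le_trans a0).
  by apply: ereal_sup_ubound; exists 0; rewrite in_itv/= lexx ler01.
pose S (m : seq I * (nat * nat)) : set T :=
  if (m.2.2 <= m.2.1.+1)%N && uniq m.1 then
    [set w | a ^+ 2 < \sum_(i <- m.1)
      coordinate dot e gamma i (m.2.2%:R / m.2.1.+1%:R) w ^+ 2]
  else set0.
have in01 k n : (k <= n.+1)%N -> (k%:R / n.+1%:R : R) \in `[0, 1].
  by move=> kn; rewrite in_itv/= divr_ge0//= ler_pdivrMr ?ltr0n// mul1r ler_nat.
have mS m : measurable (S m).
  rewrite /S; case: ifP => // /andP[kn _].
  have mF : measurable_fun [set: T] (fun w => \sum_(i <- m.1)
      coordinate dot e gamma i (m.2.2%:R / m.2.1.+1%:R) w ^+ 2).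
    apply: measurable_sum => i; apply: measurable_funX.
    by have [gp _] := Hg i; have [] := gaussian_process_marginal _ _ _ _ _ _ gp (in01 _ _ kn).
  have := mF measurableT [set` `]a ^+ 2, +oo[] (measurable_itv _).
  rewrite setTI; congr (measurable _); apply/seteqP.
  by split=> w /=; rewrite in_itv/= andbT.
have -> : [set w | (a%:E < sup_norm gamma w)%E] =
    \bigcup_n (if unpickle n is Some m then S m else set0).
  apply/seteqP; split => w /=.
    move=> /ereal_sup_gt[_ [t [t01 ->]]]; rewrite lte_fin.
    move=> /(norm_gtP _ _ _ Hdot _ _ He _ _ a0)[s us].
    (* The path itself may fail to be norm continuous; finite sums of squared coordinates are
       continuous. *)
    have cF : {within `[0, 1], continuous (fun t => \sum_(i <- s) coordinate dot e gamma i t w ^+ 2)}.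
      by apply: within_continuous_sum_sqr => i; have [_ +] := Hg i; exact.
    move=> /(within_continuous_gt_grid _ _ _ _ cF t01)[n [k [kn h]]].
    exists (pickle (s, (n, k))) => //; rewrite pickleK /S/= kn us.
    exact: h.
  move=> [n _]; case: unpickle => // -[s [l k]]; rewrite /S/=.
  case: ifP => // /andP[kn us] h.
  apply: (@lt_le_trans _ _ (`|gamma (k%:R / l.+1%:R) w|)%:E); last first.
    by apply: ereal_sup_ubound; exists (k%:R / l.+1%:R); rewrite in01.
  rewrite lte_fin; apply/(norm_gtP _ _ _ Hdot _ _ He _ _ a0).
  by exists s.
by apply: bigcup_measurable => n _; case: unpickle.
Qed.

Lemma measurable_sup_norm_ge (R : realType) (d : measure_display) (T : measurableType d)
    (P : probability T R) (H : completeNormedModType R)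
    (dot : {dot H for idfun}) (Hdot : norm_induced_by dot)
    (I : countType) (e : I -> H) (He : orthonormal_basis dot e)
    (gamma : R -> T -> H) (r : R) :
  cylindrical_continuous_gaussian P dot e gamma ->
  measurable [set w | (r%:E <= sup_norm gamma w)%E].
Proof.
move=> Hg; rewrite -[X in measurable X]setTI.
apply: emeasurable_fun_c_infty => //.
exact: measurable_sup_norm Hg.
Qed.

(** * Summation over the coordinates *)

Lemma delta_ge0 (R : realType) (d : measure_display)
    (T : measurableType d) (P : probability T R) (X : R -> T -> R) :
  (0 <= delta P X)%E.
Proof.
apply: adde_ge0.
  apply: (le_trans (sqrte_ge0 'E_P[fun w => (X 0 w ^+ 2)%R]%E)).
  by apply: ereal_sup_ubound; exists 0; rewrite in_itv/= lexx ler01.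
(* The empty sum yields nonnegativity of the integral term. *)
by have := sum_increments_le_phi_integral _ _ _ P X 0; rewrite big_ord0.
Qed.

(** When delta vanishes, the threshold x delta is 0 for every x. Letting x = n + 16 grow and
    intersecting the exceptional events leaves a null set. *)
Lemma fernique0 (R : realType) (d : measure_display)
    (T : measurableType d) (P : probability T R) (X : R -> T -> R) :
  gaussian_process P X -> continuous_process X -> delta P X = 0%E ->
  exists A : set T, [/\ measurable A, P A = 0%E &
    forall w, ~ A w -> forall t, t \in `[0, 1] -> X t w = 0].
Proof.
move=> gX cX D0.
(* The offset 16 gives 16^2 / 2 = 128, so [fernique] applies already at n = 0. *)
have q n : expR (- ((n + 16)%:R ^+ 2 / 2)) <= (n + 128)%:R^-1 :> R.
  rewrite expRN lef_pV2 ?posrE ?expR_gt0 ?ltr0n ?addn_gt0 ?orbT//.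
  apply: le_trans (expR_ge1Dx _).
  rewrite !natrD; have : 0 <= n%:R :> R by [].
  set y := n%:R => y0; have := sqr_ge0 y; rewrite sqrrD; lra.
have /choice[A hA] : forall n, exists A : set T, [/\ measurable A,
    (P A <= (2 ^+ 10 * expR 2^-1 * (n + 128)%:R^-1)%:E)%E &
    forall w, ~ A w -> forall t, t \in `[0, 1] -> X t w = 0].
  move=> n; have [||A [mA PA XA]] := fernique R d T P X 0 (n + 16)%:R gX cX D0.
  - by [].
  - by rewrite (le_trans (q n))// lef_pV2 ?posrE ?ltr0n ?addn_gt0 ?orbT// ler_nat leq_addl.
  exists A; split => //.
    rewrite (le_trans PA)// lee_fin ler_wpM2l// mulr_ge0 ?exprn_ge0// expR_ge0.
  by move=> w nA t t01; apply/eqP; rewrite -normr_le0; have := XA w nA t t01; rewrite mulr0.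
exists (\bigcap_n A n); split.
- by apply: bigcap_measurable => // n _; have [] := hA n.
- apply/eqP; rewrite eq_le measure_ge0 andbT; apply/lee_addgt0Pr => eps eps0.
  rewrite add0e.
  have C0 : 0 < 2 ^+ 10 * expR 2^-1 :> R by rewrite mulr_gt0 ?exprn_gt0 ?expR_gt0.
  have rV0 : 0 <= (eps / (2 ^+ 10 * expR 2^-1))^-1 by rewrite invr_ge0 divr_ge0 ?ltW.
  have /andP[_ h] := truncn_itv rV0.
  set n := Num.truncn _ in h.
  have [mA PA _] := hA n.
  apply: (@le_trans _ _ (P (A n))).
    apply: le_measure; rewrite ?inE//; last by move=> w; exact.
    by apply: bigcap_measurable => // k _; have [] := hA k.
  rewrite (le_trans PA)// lee_fin -ler_pdivlMl// mulrC.
  rewrite -[leRHS]invrK lef_pV2 ?posrE ?invr_gt0 ?divr_gt0 ?ltr0n ?addn_gt0 ?orbT//.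
  by rewrite (le_trans (ltW h))// ler_nat -addn1 leq_add2l.
- move=> w nA t t01; apply: contra_notP nA => Xt n _.
  by apply: contra_notP Xt => nAn; have [_ _ ] := hA n; exact.
Qed.

Lemma logterm_fin (R : realType) (D : R) : 0 < D ->
  logterm D%:E = (ln (expR 1 + D^-1))%:E /\ 1 <= ln (expR 1 + D^-1).
Proof.
move=> D0; rewrite /logterm inver gt_eqF// -EFinD.
have DV : 0 < D^-1 by rewrite invr_gt0.
have e0 := expR_gt0 (1 : R).
rewrite lne_EFin ?addr_gt0//; split => //.
by rewrite -[leLHS]expRK ler_ln ?posrE ?addr_gt0// lerDl ltW.
Qed.

Lemma coordinate_event (R : realType) (d : measure_display)
    (T : measurableType d) (P : probability T R) (X : R -> T -> R)
    (theta lambda r tau : R) :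
  gaussian_process P X -> continuous_process X ->
  (delta P X ^+ 2 * logterm (delta P X))%E = tau%:E -> tau <= theta ->
  (lambda%:E <= logterm (delta P X) / (2%:E * theta%:E))%E ->
  0 <= r -> 256 * theta <= r ^+ 2 ->
  exists A : set T, [/\ measurable A,
    (P A <= (2 ^+ 10 * expR (2^-1 + 4 * theta * lambda) * expR (- lambda * r ^+ 2) * tau)%:E)%E &
    forall w, ~ A w -> forall t, t \in `[0, 1] -> `|X t w| <= r * Num.sqrt (tau / theta)].
Proof.
move=> gX cX tauE tth hl r0 rth.
have := delta_ge0 _ _ _ P X; rewrite le_eqVlt => /predU1P[/esym D0|Dgt].
  have tau0 : tau = 0 by apply: EFin_inj; rewrite -tauE D0 expe2 !mul0e.
  have [A [mA PA XA]] := fernique0 _ _ _ _ _ gX cX D0.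
  exists A; split => //; first by rewrite PA tau0 mulr0.
  by move=> w nA t t01; rewrite XA// normr0 mulr_ge0// sqrtr_ge0.
have [D DE] : exists D : R, delta P X = D%:E.
  case E : (delta P X) Dgt tauE => [D| |]// _; first by exists D.
  (* An infinite delta is excluded: the inverse of [+oo] is 0, so the logarithm is 1 and the product
     would be infinite, not [tau]. *)
  have -> : logterm (+oo%E : \bar R) = 1%E.
    by rewrite /logterm invey adde0 lne_EFin ?expR_gt0// expRK.
  by rewrite expe2 mule1 mulyy.
rewrite DE lte_fin in Dgt.
have [lE l1] := logterm_fin _ _ Dgt.
rewrite DE in tauE hl; rewrite lE in tauE hl.
set l := ln _ in lE l1 tauE hl.
have tauD : tau = D ^+ 2 * l by apply: EFin_inj; rewrite -tauE EFinM EFin_expe.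
have l0 : 0 < l by lra.
have tau0 : 0 < tau by rewrite tauD mulr_gt0// exprn_gt0.
have th0 : 0 < theta by lra.
have {}hl : lambda <= l / (2 * theta).
  by move: hl; rewrite -EFinM inver gt_eqF ?mulr_gt0// -EFinM lee_fin.
(* Chosen so that [x * D] equals [r * Num.sqrt (tau / theta)]. *)
pose x := r * Num.sqrt (l / theta).
have lth : 0 <= l / theta by rewrite divr_ge0 ?ltW.
have x0 : 0 <= x by rewrite mulr_ge0// sqrtr_ge0.
have x2 : x ^+ 2 = r ^+ 2 * (l / theta) by rewrite exprMn sqr_sqrtr.
(* Then exp(x^2/2) >= 1 + 128, as [fernique] requires; [l >= 1] is used here. *)
have x256 : 256 <= x ^+ 2.
  rewrite x2 mulrA ler_pdivlMr//.
  by apply: le_trans rth _; rewrite ler_peMr// sqr_ge0.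
have qx : expR (- (x ^+ 2 / 2)) <= 128^-1.
  rewrite expRN lef_pV2 ?posrE ?expR_gt0//.
  by apply: le_trans (expR_ge1Dx _); lra.
have [A [mA PA XA]] := fernique _ _ _ _ _ _ x gX cX DE x0 qx.
have c0 : 0 < 2 ^+ 10 :> R by rewrite exprn_gt0.
move: (2 ^+ 10 : R) c0 PA => c c0 PA.
exists A; split => //.
- apply: le_trans PA _; rewrite lee_fin.
  suff h : expR (- (x ^+ 2 / 2)) <= expR (4 * theta * lambda) * (expR (- lambda * r ^+ 2) * tau).
    have ce0 : 0 <= c * expR 2^-1 by rewrite mulr_ge0 ?expR_ge0// ltW.
    apply: le_trans (ler_wpM2l ce0 h) _; rewrite expRD le_eqVlt; apply/orP; left.
    by apply/eqP; ring.
  apply: (@le_trans _ _ (expR (4 * theta * lambda) * (expR (- lambda * r ^+ 2) * expR (- (2 * l))))).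
    rewrite -!expRD ler_expR x2.
    (* Expanded, this says x^2/2 >= lambda r^2 + 2 l - 4 theta lambda: the portion 4 theta of r^2
       pays for the factor exp(-2 l). *)
    have : 0 <= (r ^+ 2 - 4 * theta) * (l / (2 * theta) - lambda).
      by rewrite mulr_ge0// subr_ge0//; lra.
    have -> : r ^+ 2 * (l / theta) / 2 = r ^+ 2 * (l / (2 * theta)) by field; lra.
    rewrite mulrBl !mulrBr.
    have -> : 4 * theta * (l / (2 * theta)) = 2 * l by field; lra.
    lra.
  rewrite ler_pM2l ?expR_gt0// ler_pM2l ?expR_gt0//.
  (* exp(-2 l) = (e + 1/D)^-2 <= D^2 <= D^2 l = tau, which is summable over the coordinates. *)
  have -> : expR (- (2 * l)) = (expR l ^- 2) by rewrite expRN expRM_natl.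
  rewrite /l lnK ?posrE ?addr_gt0 ?expR_gt0 ?invr_gt0//.
  apply: (@le_trans _ _ (D ^+ 2)); last by rewrite tauD ler_peMr// sqr_ge0.
  rewrite -[leRHS]invrK lef_pV2 ?posrE ?invr_gt0 ?exprn_gt0 ?addr_gt0 ?expR_gt0 ?invr_gt0//.
  rewrite -exprVn lerXn2r ?nnegrE ?addr_ge0 ?invr_ge0 ?expR_ge0 ?ltW//.
  by rewrite ltrDr expR_gt0.
- move=> w nA t t01; apply: le_trans (XA w nA t t01) _.
  have -> : tau / theta = D ^+ 2 * (l / theta) by rewrite tauD mulrA.
  rewrite (sqrtrM (l / theta) (sqr_ge0 D)) sqrtr_sqr ger0_norm ?(ltW Dgt)//.
  by rewrite /x -mulrA [_ * D]mulrC.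
Qed.

Lemma measure_countable_union_le (R : realType) (d : measure_display)
    (T : measurableType d) (P : probability T R) (I : countType)
    (A : I -> set T) (b : I -> R) (B : R) :
  (forall i, measurable (A i)) -> (forall i, P (A i) <= (b i)%:E)%E ->
  (forall s, uniq s -> \sum_(i <- s) b i <= B) ->
  measurable [set w | exists i, A i w] /\
  (P [set w | exists i, A i w] <= B%:E)%E.
Proof.
move=> mA PA bB.
(* With [pickle_inv] each index has exactly one code, so initial segments of codes give
   duplicate-free lists. *)
pose F n : set T := if pickle_inv n is Some i then A i else set0.
have -> : [set w | exists i, A i w] = \bigcup_n F n.
  apply/seteqP; split=> w /=.
    by move=> [i Ai]; exists (pickle i) => //; rewrite /F pickleK_inv.
  by move=> [n _]; rewrite /F; case: pickle_inv => // i; exists i.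
have mF n : measurable (F n) by rewrite /F; case: pickle_inv.
have mU : measurable (\bigcup_n F n) by exact: bigcup_measurable.
split => //; apply: (le_trans (generalized_Boole_inequality _ mF mU)).
apply: lime_le; first by apply: is_cvg_nneseries => n _ _; exact: measure_ge0.
apply: nearW => n; pose s := pmap (@pickle_inv I) (iota 0 n).
have us : uniq s by apply: (pmap_uniq (@pickle_invK I)); exact: iota_uniq.
apply: (@le_trans _ _ (\sum_(i <- s) b i)%:E); last by rewrite lee_fin bB.
rewrite /s /index_iota subn0; elim: (iota 0 n) => [|m r ih].
  by rewrite !big_nil.
rewrite big_cons /= {1}/F; case: pickle_inv => [i|] /=.
  by rewrite big_cons EFinD; exact: leeD.
by rewrite measure0 add0e.
Qed.

Lemma sum_le_esum (R : realType) (I : choiceType) (a : I -> \bar R) (s : seq I) :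
  uniq s -> (\sum_(i <- s) a i <= \esum_(i in [set: I]) a i)%E.
Proof.
move=> us; rewrite (fsbig_seq _ _ us).
by apply: ereal_sup_ubound; exists [set` s] => //; split.
Qed.

Lemma logterm_ge0 (R : realType) (x : \bar R) : (0 <= x -> 0 <= logterm x)%E.
Proof.
move=> x0; rewrite lne_ge0; apply: (@le_trans _ _ (expR 1)%:E).
  by rewrite lee_fin ltW// expR_gt1.
by rewrite leeDl// inve_ge0.
Qed.

Theorem theorem2p2 (R : realType) (d : measure_display) (T : measurableType d)
  (P : probability T R) (H : completeNormedModType R)
  (dot : {dot H for idfun}) (Hdot : norm_induced_by dot) (Hsep : separable H)
  (I : countType) (e : I -> H) (He : orthonormal_basis dot e)
  (gamma : R -> T -> H)
  (Hgamma : cylindrical_continuous_gaussian P dot e gamma)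
  (Hmean : cylindrical_zero_mean P dot e gamma)
  (Htheta : (theta P dot e gamma < +oo)%E)
  (lambda : R) (Hlambda0 : 0 < lambda)
  (Hlambda : (lambda%:E <
     ereal_inf [set logterm (delta P (coordinate dot e gamma i)) /
                      (2%:E * theta P dot e gamma) | i in [set: I]])%E) :
  exists c : R, 0 < c /\
    forall r : R, 0 <= r ->
      (P [set w | r%:E <= sup_norm gamma w] <=
        (c * expR (- lambda * r ^+ 2))%:E)%E.
Proof.
pose X i := coordinate dot e gamma i.
pose term i := (delta P (X i) ^+ 2 * logterm (delta P (X i)))%E.
have term0 i : (0 <= term i)%E.
  have D0 := delta_ge0 _ _ _ P (X i).
  by apply: mule_ge0; [exact: expe_ge0|exact: logterm_ge0].
have th0 : (0 <= theta P dot e gamma)%E by apply: esum_ge0 => i _; exact: term0.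
have [th thE] : exists th, theta P dot e gamma = th%:E.
  by exists (fine (theta P dot e gamma)); rewrite fineK// ge0_fin_numE.
rewrite thE lee_fin in th0; rewrite thE in Hlambda.
have sum_term s : uniq s -> (\sum_(i <- s) term i <= th%:E)%E.
  by move=> us; rewrite -thE; exact: sum_le_esum.
have term_le i : (term i <= th%:E)%E.
  by have := sum_term [:: i] isT; rewrite big_seq1.
pose tau i := fine (term i).
have tauE i : term i = (tau i)%:E.
  by rewrite fineK// ge0_fin_numE// (le_lt_trans (term_le i))// ltry.
have tau0 i : 0 <= tau i by rewrite -lee_fin -tauE.
have tau_le i : tau i <= th by rewrite -lee_fin -tauE.
have sum_tau s : uniq s -> \sum_(i <- s) tau i <= th.
  move=> us; rewrite -lee_fin -sumEFin; apply: le_trans (sum_term s us).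
  by rewrite le_eqVlt; apply/orP; left; apply/eqP; apply: eq_bigr => i _; rewrite tauE.
have lam i : (lambda%:E <= logterm (delta P (X i)) / (2%:E * th%:E))%E.
  by apply: (le_trans (ltW Hlambda)); apply: ereal_inf_lbound; exists i.
pose K : R := 2 ^+ 10 * expR (2^-1 + 4 * th * lambda).
have K0 : 0 <= K by rewrite mulr_ge0 ?exprn_ge0// expR_ge0.
(* Off the exceptional events the supremum is at most [r']; the strict gap is needed to exclude the
   closed event at level [r]. *)
have main (r r' : R) : 0 <= r' -> r' < r -> 256 * th <= r' ^+ 2 ->
    (P [set w | (r%:E <= sup_norm gamma w)%E] <=
      (K * expR (- lambda * r' ^+ 2) * th)%:E)%E.
  move=> r0 rr rth.
  have /choice[A hA] : forall i, exists A : set T, [/\ measurable A,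
      (P A <= (K * expR (- lambda * r' ^+ 2) * tau i)%:E)%E &
      forall w, ~ A w -> forall t, t \in `[0, 1] ->
        `|X i t w| <= r' * Num.sqrt (tau i / th)].
    move=> i; have [gX cX] := Hgamma i.
    exact: coordinate_event gX cX (tauE i) (tau_le i) (lam i) r0 rth.
  have Ke0 : 0 <= K * expR (- lambda * r' ^+ 2) by rewrite mulr_ge0// expR_ge0.
  have [mU PU] : measurable [set w | exists i, A i w] /\
      (P [set w | exists i, A i w] <= (K * expR (- lambda * r' ^+ 2) * th)%:E)%E.
    apply: (measure_countable_union_le _ _ _ _ _ _
      (fun i => K * expR (- lambda * r' ^+ 2) * tau i)).
    - by move=> i; have [] := hA i.
    - by move=> i; have [] := hA i.
    - by move=> s us; rewrite -mulr_sumr ler_wpM2l// sum_tau.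
  apply: le_trans PU; apply: le_measure; rewrite ?inE//.
    exact: measurable_sup_norm_ge Hgamma.
  move=> w /=; apply: contraPP => nA; apply/negP; rewrite -ltNge.
  apply: (@le_lt_trans _ _ r'%:E); last by rewrite lte_fin.
  apply: ge_ereal_sup => _ [t [t01 ->]]; rewrite lee_fin leNgt; apply/negP.
  move=> /(norm_gtP _ _ _ Hdot _ _ He _ _ r0)[s us]; apply/negP; rewrite -leNgt.
  apply: (@le_trans _ _ (\sum_(i <- s) r' ^+ 2 * (tau i / th))).
    apply: ler_sum => i _.
    have tt0 : 0 <= tau i / th by rewrite divr_ge0.
    have nAi : ~ A i w by move=> Ai; apply: nA; exists i.
    have [_ _ /(_ w nAi t t01) h] := hA i.
    rewrite -[leRHS](_ : (r' * Num.sqrt (tau i / th)) ^+ 2 = _).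
      by rewrite -[leLHS]real_normK ?num_real// lerXn2r// nnegrE// mulr_ge0// sqrtr_ge0.
    by rewrite exprMn sqr_sqrtr.
  rewrite -mulr_sumr -mulr_suml ler_piMr ?sqr_ge0//.
  (* For [th = 0] the quotient is 0 by the convention on inverses. *)
  have [->|thN0] := eqVneq th 0; first by rewrite invr0 mulr0.
  by rewrite ler_pdivrMr ?lt_def ?thN0// mul1r sum_tau.
(* For r >= [r1], 1/r <= 1 and so r - 1/r >= 16 sqrt(th), whose square is 256 th. *)
pose r1 := 16 * Num.sqrt th + 1.
have s0 : 0 <= Num.sqrt th by exact: sqrtr_ge0.
(* The first summand makes the bound at least 1 below [r1]. The second serves r >= [r1] with r' = r
   - 1/r, since r'^2 >= r^2 - 2 costs only the factor exp(2 lambda). *)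
exists (expR (lambda * r1 ^+ 2) + K * th * expR (2 * lambda)); split.
  by rewrite ltr_wpDr ?expR_gt0// !mulr_ge0// expR_ge0.
move=> r r0; have [rr1|r1r] := ltP r r1.
  apply: (@le_trans _ _ 1%E).
    by apply: probability_le1; exact: measurable_sup_norm_ge Hgamma.
  rewrite lee_fin mulrDl -[leLHS]addr0 lerD//; last first.
    by rewrite !mulr_ge0// ?expR_ge0.
  rewrite -expRD -[leLHS]expR0 ler_expR mulNr -mulrBr.
  apply: mulr_ge0; first exact: ltW.
  by rewrite subr_ge0 lerXn2r ?nnegrE// ltW// (le_lt_trans r0).
have r1' : 1 <= r by rewrite (le_trans _ r1r)// /r1; lra.
have rV : 0 < r^-1 by rewrite invr_gt0; lra.
have rV1 : r^-1 <= 1 by rewrite invf_le1//; lra.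
have rth : 16 * Num.sqrt th <= r - r^-1 by move: r1r; rewrite /r1; lra.
apply: le_trans (main r (r - r^-1) _ _ _) _.
- by lra.
- by lra.
- apply: (@le_trans _ _ ((16 * Num.sqrt th) ^+ 2)).
    by rewrite exprMn sqr_sqrtr// -natrX.
  by rewrite lerXn2r// nnegrE; lra.
- rewrite lee_fin mulrDl.
  apply: (@le_trans _ _ (K * th * expR (2 * lambda) * expR (- lambda * r ^+ 2))); last first.
    by rewrite lerDr mulr_ge0// expR_ge0.
  rewrite -[leRHS]mulrA -expRD [leLHS]mulrAC ler_wpM2l ?mulr_ge0// ler_expR.
  have rp : 0 < r by exact: lt_le_trans r1'.
  have rrV : r * r^-1 = 1 by rewrite divff// gt_eqF.
  have -> : (r - r^-1) ^+ 2 = r ^+ 2 - 2 * (r * r^-1) + r^-1 ^+ 2 by ring.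
  rewrite rrV; have := mulr_ge0 (ltW Hlambda0) (sqr_ge0 r^-1).
  lra.
Qed.
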